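(* Let $\alpha$ be a constant with $2\le\alpha\le 3$. Consider $n$ jobs $1,\dots,n$ with positive workloads $w_1,\dots,w_n$ and positive penalty factors $p_1,\dots,p_n$. Problem A: a schedule consists of an order $\pi$ (a bijection from jobs to ranks $\{1,\dots,n\}$) and a vector of positive execution lengths $\vec\ell=(\ell_1,\dots,\ell_n)$. Its cost is $$A_{\vec w,\vec p}(\pi,\vec\ell)=\sum_{i} w_i^\alpha \ell_i^{1-\alpha}+\sum_i p_i C_i,\qquad C_i=\sum_{j:\pi(j)\le\pi(i)}\ell_j .$$ Problem B: for an order $\sigma$ on a unit-speed machine where job $i$ has processing time $p_i$ and weight $w_i$, define $$B_{\vec w,\vec p}(\sigma)=\sum_j w_j C_j^{(\alpha-1)/\alpha},\qquad C_j=\sum_{i:\sigma(i)\le\sigma(j)}p_i .$$ Let $\pi$ be any job order and let $\sigma$ be its reverse, $\sigma(i)=n+1-\pi(i)$. Let $\vec\ell$ be the positive execution length vector minimizing $A_{\vec w,\vec p}(\pi,\cdot)$. Then $$A_{\vec w,\vec p}(\pi,\vec\ell)=\alpha(\alpha-1)^{(1-\alpha)/\alpha}\, B_{\vec w,\vec p}(\sigma).$$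
   Context: A job with workload $w_i$ run at constant speed $s_i$ has execution length $\ell_i=w_i/s_i$. It consumes energy $\ell_i s_i^\alpha=w_i^\alpha\ell_i^{1-\alpha}$. *)

(* Defs.v *)
From mathcomp Require Import all_boot all_order all_fingroup all_algebra.
From mathcomp Require Import all_classical all_reals all_analysis.

Set Implicit Arguments.
Unset Strict Implicit.
Unset Printing Implicit Defensive.

Import Order.TTheory GRing.Theory Num.Theory.

Local Open Scope ring_scope.

(* Jobs are the elements of 'I_n, and an order is a permutation of 'I_n.  The
   rank is shifted by one so that it ranges over {1, ..., n}. *)
Definition rank (n : nat) (pi : 'S_n) (i : 'I_n) : nat := (pi i).+1.

Definition completion (R : realType) (n : nat) (pi : 'S_n) (d : 'I_n -> R)
    (i : 'I_n) : R :=
  \sum_(j < n | (rank pi j <= rank pi i)%N) d j.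

Definition costA (R : realType) (n : nat) (alpha : R) (w p : 'I_n -> R)
    (pi : 'S_n) (l : 'I_n -> R) : R :=
  \sum_(i < n) w i `^ alpha * l i `^ (1 - alpha) +
  \sum_(i < n) p i * completion pi l i.

Definition costB (R : realType) (n : nat) (alpha : R) (w p : 'I_n -> R)
    (sigma : 'S_n) : R :=
  \sum_(j < n) w j * completion sigma p j `^ ((alpha - 1) / alpha).

Definition positive_vec (R : realType) (n : nat) (v : 'I_n -> R) : Prop :=
  forall i, 0 < v i.

Definition minimizesA (R : realType) (n : nat) (alpha : R) (w p : 'I_n -> R)
    (pi : 'S_n) (l : 'I_n -> R) : Prop :=
  positive_vec l /\
  forall l' : 'I_n -> R, positive_vec l' ->
    costA alpha w p pi l <= costA alpha w p pi l'.

(* Main.v *)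
Require Import Defs.
From mathcomp Require Import all_boot all_order all_fingroup all_algebra.
From mathcomp Require Import all_classical all_reals all_analysis.
From mathcomp Require Import ring lra zify.

Import Order.TTheory GRing.Theory Num.Theory.

Local Open Scope ring_scope.

(** Exchanging the two summations turns the delay cost into
    [\sum_j l_j Q_j], where [Q_j] is the total penalty of the jobs ranked at or
    after [j], i.e. the completion time of [j] in Problem B under the reverse
    order.  The cost is thereby separable, and each term
    [w^a l^(1-a) + Q l] is minimised at [l = w ((a-1)/Q)^(1/a)], with minimum
    [a (a-1)^((1-a)/a) w Q^((a-1)/a)].  The lower bound is a Bernoulli
    inequality in the ratio of [l] to that minimiser. *)

(** Apply [1 + x <= expR x] at [(1 - a) * ln u] and at [ln u], the latter scaled by [a - 1]: the
    logarithms cancel. Equality holds at [u = 1]. *)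
Lemma powR_tangent_ge (R : realType) (a u : R) : 1 <= a -> 0 < u ->
  a <= u `^ (1 - a) + (a - 1) * u.
Proof.
move=> a1 u0; rewrite /powR gt_eqF//.
have h1 := expR_ge1Dx ((1 - a) * ln u).
have h2 : 1 + ln u <= u by rewrite -{2}(lnK u0) expR_ge1Dx.
have : (a - 1) * (1 + ln u) <= (a - 1) * u by rewrite ler_wpM2l// subr_ge0.
lra.
Qed.

Section single_job.
Context {R : realType}.
Variables (a w Q : R).
Hypotheses (a1 : 1 < a) (w0 : 0 < w) (Q0 : 0 < Q).

Definition job_cost (x : R) : R := w `^ a * x `^ (1 - a) + Q * x.

Definition job_argmin : R := w * ((a - 1) / Q) `^ a^-1.

Definition job_min : R :=
  a * (a - 1) `^ ((1 - a) / a) * (w * Q `^ ((a - 1) / a)).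

(** The optimal length per unit of workload, that is, the inverse of the optimal speed. *)
Let m : R := ((a - 1) / Q) `^ a^-1.

Let m_gt0 : 0 < m.
Proof. by rewrite powR_gt0// divr_gt0// subr_gt0. Qed.

Lemma job_argmin_gt0 : 0 < job_argmin.
Proof. exact: mulr_gt0. Qed.

Let job_energy_argmin : w `^ a * job_argmin `^ (1 - a) = w * m `^ (1 - a).
Proof.
rewrite powRM ?(ltW w0) ?(ltW m_gt0)// mulrA -powRD; last first.
  by apply/implyP => _; rewrite gt_eqF.
by rewrite addrC subrK powRr1 // ltW.
Qed.

(* First-order optimality at the minimiser. *)
Let job_delay_argmin : Q * job_argmin = (a - 1) * (w * m `^ (1 - a)).
Proof.
have a0 : a != 0 by rewrite gt_eqF// (lt_trans ltr01).
have ma : m `^ a = (a - 1) / Q.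
  by rewrite -powRrM mulVf// powRr1// ltW// divr_gt0// subr_gt0.
(* Splitting [m] into its powers [1 - a] and [a] exposes the energy factor, while the power [a]
   cancels [Q]. *)
have -> : job_argmin = w * (m `^ (1 - a) * m `^ a).
  rewrite -powRD; last by apply/implyP => _; rewrite gt_eqF.
  by rewrite subrK powRr1// ltW.
by rewrite ma; field; rewrite gt_eqF.
Qed.

Let job_minE : job_min = a * (w * m `^ (1 - a)).
Proof.
have QV : Q^-1 `^ (a^-1 * (1 - a)) = Q `^ ((a - 1) / a).
  by rewrite -(powR_inv1 (ltW Q0)) -powRrM; congr (_ `^ _); ring.
rewrite /m -powRrM powRM ?QV ?invr_ge0 ?subr_ge0 ?ltW// /job_min (mulrC a^-1).
ring.
Qed.

Lemma job_cost_argmin : job_cost job_argmin = job_min.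
Proof.
by rewrite /job_cost job_energy_argmin job_delay_argmin job_minE; ring.
Qed.

Lemma job_min_le x : 0 < x -> job_min <= job_cost x.
Proof.
move=> x0; have y0 := job_argmin_gt0.
set u := x / job_argmin; set e := w * m `^ (1 - a).
have u0 : 0 < u by rewrite divr_gt0.
have -> : x = job_argmin * u by rewrite mulrC divfK ?gt_eqF.
(* At the minimiser the delay is [a - 1] times the energy [e], so [e] factors out and only the ratio
   [u] remains. *)
have -> : job_cost (job_argmin * u) = e * (u `^ (1 - a) + (a - 1) * u).
  rewrite /job_cost powRM ?(ltW y0) ?(ltW u0)//.
  rewrite (mulrA Q) (mulrA (w `^ a)).
  by rewrite job_energy_argmin job_delay_argmin -/e; ring.
rewrite job_minE mulrC ler_wpM2l ?powR_tangent_ge// ?(ltW a1)//.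
by rewrite mulr_ge0 ?powR_ge0// ltW.
Qed.

End single_job.

Lemma completion_gt0 (R : realType) (n : nat) (pi : 'S_n) (d : 'I_n -> R) i :
  positive_vec d -> 0 < completion pi d i.
Proof.
move=> d0; rewrite /completion (bigD1 i)//= ltr_pwDl//.
by apply: sumr_ge0 => j _; exact: ltW.
Qed.

Lemma sum_completion_reverse (R : realType) (n : nat) (pi sigma : 'S_n)
    (p l : 'I_n -> R) :
  (forall i, rank sigma i = (n.+1 - rank pi i)%N) ->
  \sum_i p i * completion pi l i = \sum_j completion sigma p j * l j.
Proof.
move=> hsigma; rewrite /completion.
under eq_bigr do rewrite mulr_sumr.
rewrite (exchange_big_dep predT)//=; apply: eq_bigr => j _.
rewrite mulr_suml; apply: eq_bigl => i; rewrite !hsigma /rank.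
(* Ranks are at most [n], so the natural subtraction does not truncate and reversal flips the
   comparison. *)
by move: (ltn_ord (pi i)) (ltn_ord (pi j)); lia.
Qed.

Lemma costA_reverseE (R : realType) (n : nat) (a : R) (w p l : 'I_n -> R)
    (pi sigma : 'S_n) :
  (forall i, rank sigma i = (n.+1 - rank pi i)%N) ->
  costA a w p pi l = \sum_i job_cost a (w i) (completion sigma p i) (l i).
Proof.
by move=> hs; rewrite /costA (sum_completion_reverse _ _ _ _ _ _ hs) -big_split.
Qed.

Theorem theorem1 (R : realType) (alpha : R) (halpha : 2 <= alpha <= 3)
    (n : nat) (w p : 'I_n -> R)
    (hw : positive_vec w) (hp : positive_vec p)
    (pi sigma : 'S_n)
    (hsigma : forall i : 'I_n, rank sigma i = (n.+1 - rank pi i)%N)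
    (l : 'I_n -> R) (hl : minimizesA alpha w p pi l) :
  costA alpha w p pi l =
  alpha * (alpha - 1) `^ ((1 - alpha) / alpha) * costB alpha w p sigma.
Proof.
have a1 : 1 < alpha by case/andP: halpha; lra.
have Q0 i : 0 < completion sigma p i by exact: completion_gt0.
have -> : alpha * (alpha - 1) `^ ((1 - alpha) / alpha) * costB alpha w p sigma
    = \sum_i job_min alpha (w i) (completion sigma p i).
  by rewrite /costB mulr_sumr.
case: hl => l0 lmin; apply/eqP; rewrite eq_le; apply/andP; split.
  (* Lengths are constrained only by positivity, so the jobwise minimisers form an admissible
     competitor. *)
  pose l' i := job_argmin alpha (w i) (completion sigma p i).
  have l'0 : positive_vec l' by move=> i; exact: job_argmin_gt0.
  apply: (le_trans (lmin _ l'0)).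
  rewrite (costA_reverseE _ _ _ _ _ _ _ _ hsigma) le_eqVlt.
  by apply/orP/or_introl/eqP/eq_bigr => i _; exact: job_cost_argmin.
rewrite (costA_reverseE _ _ _ _ _ _ _ _ hsigma).
by apply: ler_sum => i _; exact: job_min_le.
Qed.
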